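(* Let $\{\lambda^{(j)}_k\}_{k=1}^\infty$, $j=1,\dots,p$, be non-decreasing sequences of positive real numbers, with counting functions $N_j$, and let $N$ be the counting function of the $p$-fold products. Assume that there are non-negative numbers $\tau<\eta<\alpha$ and an index $l\in\{1,\dots,p\}$ such that $N_j(\lambda)=O(\lambda^\tau)$ as $\lambda\to\infty$ for $j\ne l$, and $$N_l(\lambda)=A_l\lambda^{\alpha}+O(\lambda^{\eta}),\quad\lambda\to\infty,$$ with $A_l\neq 0$. Then $$N(\lambda)=A\lambda^{\alpha}+O(\lambda^{\eta}),\quad\lambda\to\infty,$$ where $$A=A_l\prod_{j\ne l}\left(\sum_{k=1}^\infty\frac{1}{(\lambda^{(j)}_k)^{\alpha}}\right).$$
   Context: $N_j(\lambda)=\#\{k\in\mathbb{N}:\lambda^{(j)}_k\le\lambda\}$ for $j=1,\dots,p$, and $N(\lambda)=\#\{(k_1,\dots,k_p)\in\mathbb{N}^p:\lambda^{(1)}_{k_1}\lambda^{(2)}_{k_2}\cdots\lambda^{(p)}_{k_p}\le\lambda\}$, where here $\mathbb{N}=\{1,2,\dots\}$ indexes the sequences. Empty products equal $1$. *)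

(* Defs.v *)
From HB Require Import structures.
From mathcomp Require Import all_boot all_order all_algebra.
From mathcomp Require Import all_classical all_reals all_analysis.
Set Implicit Arguments.
Unset Strict Implicit.
Unset Printing Implicit Defensive.
Import Order.TTheory GRing.Theory Num.Theory.
Import numFieldNormedType.Exports.

Local Open Scope classical_set_scope.
Local Open Scope ring_scope.

(* The count is taken in the extended reals so that an infinite sublevel set
   counts as +oo rather than as a junk finite value. *)
Definition counting_fun (R : realType) (T : choiceType) (v : T -> R) (x : R)
  : \bar R := counting [set t | v t <= x].

(* Sequences are indexed from 0 here: [u j k] is the (k+1)-st term of the
   j-th sequence, so that a multi-index is a function ['I_p -> nat]. *)
Definition prod_family (R : realType) (p : nat) (u : 'I_p -> nat -> R)
  (k : {ffun 'I_p -> nat}) : R := \prod_(j < p) u j (k j).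

(* The library declares this instance for [eventually] but not for the filter
   +oo on R; the Landau notation below needs it. *)
Canonical pinfty_nbhs_filter_on (R : realType) :=
  FilterType (pinfty_nbhs R) _.

(* f x = O(g x) as x tends to +oo, for f extended-real valued: f is finite
   near +oo and its real value is O(g) there.  The finiteness clause is needed
   because [fine] sends infinite values to 0. *)
Definition bigO_pinfty (R : realType) (f : R -> \bar R) (g : R -> R) : Prop :=
  (\forall x \near +oo, f x \is a fin_num) /\
  (fun x => fine (f x)) =O_+oo g.

(* Main.v *)
Require Import Defs.
From HB Require Import structures.
From mathcomp Require Import all_boot all_order all_algebra finmap.
From mathcomp Require Import all_classical all_reals all_analysis.
From mathcomp Require Import ring lra.
Import Order.TTheory GRing.Theory Num.Theory.
Import numFieldNormedType.Exports.
Local Open Scope classical_set_scope.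
Local Open Scope ring_scope.

(** Fix the sequence with counting function [A_l x^alpha + O(x^eta)] and multiply
    the others in one at a time.  If [f] is a family of positive reals, bounded
    away from [0], with counting function [M], and [v] is a positive sequence,
    the products [f t * v k] have counting function [N x = \sum_k M (x / v k)].

    Once the estimate [`|M y - A y^alpha| <= C y^eta] is known for every [y > 0],
    and not only for large [y], it can be summed over [k]:
    [`|N x - A x^alpha \sum_k 1 / (v k)^alpha| <= C x^eta \sum_k 1 / (v k)^eta],
    an estimate of the same kind (lemma [power_law_mul]).  Passing from large [y]
    to all [y > 0] costs nothing: [M] vanishes below the lower bound [m] of [f]
    and is bounded on any compact interval, while [y^eta >= m^eta] for [y >= m]
    and [y^alpha = O(y^eta)] near [0], as [eta <= alpha]
    (lemma [bigO_power_law]).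

    The series converge because, [v] being non-decreasing, [k + 1] of its terms are at
    most [v k]; hence [k + 1 = O((v k)^tau)] (lemma [bigO_counting_growth]) and [1 / (v k)^eta = O((k + 1)^(- eta / tau))] with
    [eta / tau > 1] (lemma [is_cvg_series_powR_growth]); a sequence with
    [tau = 0] cannot exist. *)

(** * Convergence of the zeta-type series *)

Lemma powRV {R : realType} (x r : R) : 0 <= x -> x^-1 `^ r = (x `^ r)^-1.
Proof. by move=> x0; rewrite -powR_inv1// -powRrM mulN1r powRN. Qed.

(** The convexity inequality that compares the series of the [n^-(r + 1)] with a
    telescoping one. *)
Lemma powR_telescope_le {R : realType} (a r : R) : 0 < a -> 0 < r ->
  r * ((a + 1) `^ (r + 1))^-1 <= a `^ (- r) - (a + 1) `^ (- r).
Proof.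
move=> a0 r0; have b0 : 0 < a + 1 by rewrite addr_gt0.
have lnab : (a + 1)^-1 <= ln ((a + 1) / a).
  rewrite -[(a + 1) / a]invf_div lnV ?posrE ?divr_gt0// lerNr.
  have -> : a / (a + 1) = 1 + - (a + 1)^-1 by field; rewrite gt_eqF.
  apply: le_ln1Dx; rewrite ltrN2 invf_lt1//; lra.
have -> : a `^ (- r) = (a + 1) `^ (- r) * ((a + 1) / a) `^ r.
  rewrite powRM ?invr_ge0 ?ltW// mulrA -powRD; last first.
    by rewrite (gt_eqF b0) implybT.
  by rewrite addNr powRr0 mul1r powRV ?ltW// powRN.
have -> : ((a + 1) `^ (r + 1))^-1 = (a + 1) `^ (- r) * (a + 1)^-1.
  rewrite -powRN opprD powRD; last by rewrite (gt_eqF b0) implybT.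
  by rewrite powR_inv1// ltW.
rewrite mulrCA -{3}[(a + 1) `^ (- r)]mulr1 -mulrBr.
rewrite ler_wpM2l ?powR_ge0// lerBrDl.
rewrite {1}/powR gt_eqF ?divr_gt0// (le_trans _ (expR_ge1Dx _))//.
by rewrite lerD2l ler_wpM2l// ltW.
Qed.

Lemma is_cvg_riemannR {R : realType} (s : R) :
  1 < s -> cvgn (series (riemannR s)).
Proof.
move=> s1; have r0 : 0 < s - 1 by rewrite subr_gt0.
have s0 : 0 <= s by rewrite ltW// (lt_trans _ s1).
have bnd n : (s - 1) * series (riemannR s) n.+1 <=
    (s - 1) + 1 - n.+1%:R `^ (- (s - 1)).
  elim: n => [|n IHn].
    by rewrite /series/= big_nat1 /riemannR !powR1 invr1; lra.
  rewrite seriesSr mulrDr.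
  have := @powR_telescope_le R n.+1%:R (s - 1) (ltr0Sn _ _) r0.
  rewrite subrK natr1 => tel; rewrite /riemannR in IHn *; lra.
apply: nondecreasing_is_cvgn.
  by apply: nondecreasing_series => n _ _; rewrite ltW// riemannR_gt0.
exists (((s - 1) + 1) / (s - 1)) => _ [n _ <-].
rewrite ler_pdivlMr// mulrC.
have le_S : series (riemannR s) n <= series (riemannR s) n.+1.
  by rewrite seriesSr lerDl ltW// riemannR_gt0.
apply: (le_trans (ler_wpM2l (ltW r0) le_S)).
by apply: (le_trans (bnd n)); rewrite gerBl powR_ge0.
Qed.

(** The hypothesis on [k + 1] is the bound [O(x^tau)] on the counting function
    of [v], read at the points [x = v k]; the series is compared with the one of
    the [(k + 1)^(- eta / tau)]. *)
Lemma is_cvg_series_powR_growth {R : realType} (v : nat -> R) (C tau eta : R) :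
  (forall k, 0 < v k) -> 0 <= tau -> tau < eta ->
  (forall k, k.+1%:R <= C * v k `^ tau) ->
  cvgn [series 1 / v k `^ eta]_k.
Proof.
move=> v0 tau0 te grow.
have C0 : 0 < C.
  have := lt_le_trans (ltr0Sn R 0) (grow 0%N).
  by rewrite pmulr_lgt0// powR_gt0.
(* If [tau = 0] the growth bound would read [k + 1 <= C] for every [k]. *)
have taugt0 : 0 < tau.
  rewrite lt_neqAle tau0 andbT; apply/eqP => tau_eq0.
  have := grow (Num.truncn C); rewrite -tau_eq0 powRr0 mulr1.
  by rewrite leNgt truncnS_gt.
have s1 : 1 < eta / tau by rewrite ltr_pdivlMr// mul1r.
have s0 : 0 <= eta / tau by rewrite ltW// (lt_trans _ s1).
apply: (@series_le_cvg _ _ (C `^ (eta / tau) *: riemannR (eta / tau))).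
- by move=> k; rewrite divr_ge0// powR_ge0.
- by move=> k; rewrite mulr_ge0 ?powR_ge0// ltW// riemannR_gt0.
- move=> k; rewrite fctE -[_ *: _]/(_ * _) /riemannR /= div1r.
  rewrite ler_pdivlMr ?powR_gt0// mulrC ler_pdivrMr ?powR_gt0//.
  have -> : v k `^ eta = (v k `^ tau) `^ (eta / tau).
    by rewrite -powRrM mulrC divfK// gt_eqF.
  rewrite -powRM ?powR_ge0 ?(ltW C0)//.
  apply: (ge0_ler_powR s0); rewrite ?nnegrE//.
  exact: mulr_ge0 (ltW C0) (powR_ge0 _ _).
- exact/is_cvg_seriesZ/is_cvg_riemannR.
Qed.

Lemma is_cvg_series_powR_le {R : realType} (v : nat -> R) (m eta alpha : R) :
  0 < m -> (forall k, m <= v k) -> eta <= alpha ->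
  cvgn [series 1 / v k `^ eta]_k -> cvgn [series 1 / v k `^ alpha]_k.
Proof.
move=> m0 mv ea cv; have v0 k : 0 < v k := lt_le_trans m0 (mv k).
apply: (@series_le_cvg _ _ ((m `^ (alpha - eta))^-1 *: (fun k => 1 / v k `^ eta))).
- by move=> k; rewrite divr_ge0// powR_ge0.
- by move=> k; rewrite mulr_ge0 ?invr_ge0 ?divr_ge0 ?powR_ge0.
- move=> k; rewrite fctE -[_ *: _]/(_ * _) /= !div1r -invfM.
  rewrite lef_pV2 ?posrE ?mulr_gt0 ?powR_gt0//.
  rewrite -{2}(subrK eta alpha) [v k `^ (_ - _ + _)]powRD; last first.
    by rewrite (gt_eqF (v0 k)) implybT.
  rewrite ler_wpM2r ?powR_ge0// ge0_ler_powR ?subr_ge0 ?nnegrE//.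
    exact: ltW.
  exact: ltW.
- exact: is_cvg_seriesZ.
Qed.

(** * Uniform power laws for counting functions *)

(** The family [f], restricted to the index set [D], has a counting function
    equal to [A x^alpha + O(x^eta)] uniformly over all [x > 0], not only near
    infinity; in particular its sublevel sets are finite.  The restriction to
    [D] lets multi-indices with a prescribed support live in one type. *)
Definition power_law {R : realType} {T : choiceType} (D : set T) (f : T -> R)
    (A alpha eta : R) :=
  exists C, forall x, 0 < x ->
    finite_set (D `&` [set t | f t <= x]) /\
    `|#|` fset_set (D `&` [set t | f t <= x])|%:R - A * x `^ alpha|
      <= C * x `^ eta.

Lemma card_fset_set_image {T U : choiceType} (A : set T) (phi : T -> U) :
  finite_set A -> {in A &, injective phi} ->
  #|` fset_set (phi @` A)| = #|` fset_set A|.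
Proof.
move=> finA inj; rewrite fset_set_image// card_in_imfset//= => x y.
by rewrite !in_fset_set//; exact: inj.
Qed.

(** The cardinality of a finite disjoint union of injective images. *)
Lemma card_fset_set_family {T U : choiceType} (G : nat -> set T)
    (phi : T -> nat -> U) :
  (forall k, finite_set (G k)) ->
  (forall t k t' k', G k t -> G k' t' -> phi t k = phi t' k' ->
    t = t' /\ k = k') ->
  forall n, let E := [set u | exists k t, [/\ (k < n)%N, G k t & phi t k = u]] in
    finite_set E /\ #|` fset_set E| = (\sum_(k < n) #|` fset_set (G k)|)%N.
Proof.
move=> finG inj; elim=> [|n [finE cardE]] /=.
  have -> : [set u | exists k t, [/\ (k < 0)%N, G k t & phi t k = u]] = set0.
    by apply/seteqP; split=> // u [k [t []]].
  by rewrite fset_set0 big_ord0 cardfs0.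
set E := [set u | _] in finE cardE.
have -> : [set u | exists k t, [/\ (k < n.+1)%N, G k t & phi t k = u]] =
    E `|` phi^~ n @` G n.
  apply/seteqP; split=> u /=.
    move=> [k [t [kn Gt <-]]]; move: kn; rewrite ltnS leq_eqVlt.
    by case/predU1P=> [kn|kn]; [right; exists t; rewrite -kn|left; exists k, t].
  case=> [[k [t [kn Gt <-]]]|[t Gt <-]]; first by exists k, t; rewrite ltnW.
  by exists n, t.
have finI : finite_set (phi^~ n @` G n) by exact: finite_image.
split; first by rewrite finite_setU.
rewrite fset_setU// cardfsU -fset_setI//.
have -> : E `&` phi^~ n @` G n = set0.
  apply/seteqP; split=> // u [[k [t [kn Gt <-]]] [t' Gt' /(inj _ _ _ _ Gt' Gt)]].
  by case=> _ nk; rewrite nk ltnn in kn.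
rewrite fset_set0 cardfs0 subn0 big_ord_recr/= cardE card_fset_set_image//.
by move=> t t'; rewrite !inE => Gt Gt' /(inj _ _ _ _ Gt Gt') [].
Qed.

Lemma power_law_bij {R : realType} {T T' : choiceType} (D : set T) (D' : set T')
    (f : T -> R) (f' : T' -> R) (phi : T -> T') (A alpha eta : R) :
  phi @` D = D' -> {in D &, injective phi} ->
  (forall t, D t -> f' (phi t) = f t) ->
  power_law D f A alpha eta -> power_law D' f' A alpha eta.
Proof.
move=> phiD inj f'phi [C fC]; exists C => x x0; have [fin est] := fC x x0.
have -> : D' `&` [set t | f' t <= x] = phi @` (D `&` [set t | f t <= x]).
  rewrite -phiD; apply/seteqP; split=> u /=.
    by move=> [[t Dt <-]]; rewrite f'phi// => ft; exists t.
  by move=> [t [Dt ft] <-]; rewrite f'phi//; split=> //; exists t.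
split; first exact: finite_image.
rewrite card_fset_set_image// => t t'; rewrite !inE => -[Dt _] [Dt' _].
by apply: inj; rewrite inE.
Qed.

(** The inductive step: [D'] is in bijection with the pairs [(t, k)], [t] in
    [D], through [phi], and [f'] is the product family [f t * v k]. *)
Lemma power_law_mul {R : realType} {T T' : choiceType} (D : set T) (D' : set T')
    (f : T -> R) (f' : T' -> R) (v : nat -> R) (phi : T -> nat -> T')
    (m A alpha eta : R) :
  0 < m -> (forall t, D t -> m <= f t) -> (forall k, 0 < v k) -> 0 < eta ->
  D' = [set u | exists k t, D t /\ phi t k = u] ->
  (forall t k t' k', D t -> D t' -> phi t k = phi t' k' -> t = t' /\ k = k') ->
  (forall t k, D t -> f' (phi t k) = f t * v k) ->
  cvgn [series 1 / v k `^ eta]_k -> cvgn [series 1 / v k `^ alpha]_k ->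
  power_law D f A alpha eta ->
  power_law D' f' (A * limn [series 1 / v k `^ alpha]_k) alpha eta.
Proof.
move=> m0 mf v0 eta0 defD' inj f'phi cve cva [C fC].
set Za := limn _; set ue := (fun k => 1 / v k `^ eta) in cve.
set ua := (fun k => 1 / v k `^ alpha) in cva.
exists (C * limn (series ue)) => x x0.
pose G k := D `&` [set t | f t <= x / v k].
pose E n := [set u | exists k t, [/\ (k < n)%N, G k t & phi t k = u]].
have finG k : finite_set (G k) by have [] := fC (x / v k) (divr_gt0 x0 (v0 k)).
have EP n : finite_set (E n) /\
    #|` fset_set (E n)| = (\sum_(k < n) #|` fset_set (G k)|)%N.
  apply: (@card_fset_set_family _ _ G phi finG) => t k t' k' [Dt _] [Dt' _].
  exact: inj.
(* The terms of a convergent series tend to 0, so [v] tends to infinity and only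
   finitely many [k] contribute to the count at [x]. *)
have [K _ vK] : \forall k \near \oo, x / v k < m.
  have /cvgrPdist_lt/(_ ((m / x) `^ eta)) := cvg_series_cvg_0 cve.
  rewrite powR_gt0 ?divr_gt0// => /(_ isT); apply: filterS => k.
  rewrite sub0r normrN /ue /= div1r ger0_norm ?invr_ge0 ?powR_ge0//.
  move=> lt_v; rewrite ltNge; apply/negP => le_v.
  move: lt_v; rewrite ltNge => /negP; apply; rewrite -powRV ?(ltW (v0 k))//.
  apply: (ge0_ler_powR (ltW eta0)); rewrite ?nnegrE.
  - by rewrite divr_ge0 ?ltW.
  - by rewrite invr_ge0 ltW.
  - by rewrite ler_pdivrMr// mulrC.
have ED n : (K <= n)%N -> E n = D' `&` [set u | f' u <= x].
  move=> Kn; rewrite defD'; apply/seteqP; split=> u /=.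
    move=> [k [t [_ [Dt ft] <-]]]; split; first by exists k, t.
    by rewrite f'phi// -ler_pdivlMr.
  move=> [[k [t [Dt <-]]]]; rewrite f'phi// -ler_pdivlMr// => ft.
  exists k, t; split => //; rewrite ltnNge; apply/negP => nk.
  have := vK k (leq_trans Kn nk); apply/negP; rewrite -leNgt.
  exact: le_trans (mf _ Dt) ft.
rewrite -(ED K)//; split; first by have [] := EP K.
(* The count at [x] does not depend on the truncation [n >= K], which is then
   sent to infinity. *)
have est n : (K <= n)%N ->
    `|#|` fset_set (E K)|%:R - A * series ua n * x `^ alpha|
      <= C * limn (series ue) * x `^ eta.
  move=> Kn; rewrite (ED K)// -(ED n)//; have [_ ->] := EP n.
  have C0 : 0 <= C.
    have [_ /(le_trans (normr_ge0 _))] := fC 1 ltr01.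
    by rewrite powR1 mulr1.
  have -> : A * series ua n * x `^ alpha =
      \sum_(k < n) A * (x / v k) `^ alpha.
    rewrite /series/= big_mkord mulr_sumr mulr_suml; apply: eq_bigr => k _.
    rewrite powRM ?invr_ge0 ?(ltW x0) ?(ltW (v0 k))//.
    rewrite /ua /= div1r powRV ?(ltW (v0 k))//; ring.
  rewrite natr_sum -sumrB (le_trans (ler_norm_sum _ _ _))//.
  apply: (@le_trans _ _ (\sum_(k < n) C * (x / v k) `^ eta)).
    by apply: ler_sum => k _; have [] := fC (x / v k) (divr_gt0 x0 (v0 k)).
  apply: (@le_trans _ _ (C * series ue n * x `^ eta)).
    rewrite /series/= big_mkord mulr_sumr mulr_suml; apply: ler_sum => k _.
    rewrite powRM ?invr_ge0 ?(ltW x0) ?(ltW (v0 k))//.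
    rewrite /ue /= div1r powRV ?(ltW (v0 k))//.
    by rewrite mulrA mulrAC.
  rewrite ler_wpM2r ?powR_ge0// ler_wpM2l//.
  apply: nondecreasing_cvgn_le => //.
  by apply: nondecreasing_series => k _ _; rewrite divr_ge0// powR_ge0.
have cvl : `|#|` fset_set (E K)|%:R - A * series ua n * x `^ alpha| @[n --> \oo]
    --> `|#|` fset_set (E K)|%:R - A * Za * x `^ alpha|.
  by apply: cvg_norm; apply: cvgB; [exact: cvg_cst|apply: cvgMl; apply: cvgMr].
rewrite -(cvg_lim _ cvl)//; apply: limr_le.
  by apply/cvg_ex; eexists; exact: cvl.
by exists K => // n /= Kn; exact: est.
Qed.

(** * From asymptotic to uniform estimates and back *)

Lemma counting_finE {R : realType} {T : choiceType} (B : set T) :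
  finite_set B -> counting B = (#|` fset_set B|%:R : R)%:E.
Proof. by move=> finB; rewrite /counting asboolT. Qed.

Lemma fin_num_counting {R : realType} {T : choiceType} (B : set T) :
  counting B \is a @fin_num R -> finite_set B.
Proof. by rewrite /counting; case: asboolP. Qed.

Lemma fin_num_counting_subr {R : realType} {T : choiceType} (B : set T) (r : R) :
  (counting B - r%:E)%E \is a fin_num -> finite_set B.
Proof. by rewrite fin_numB => /andP[/fin_num_counting]. Qed.

Lemma bigO_pinftyP {R : realType} {T : choiceType} (f : T -> R) (h g : R -> R) :
  bigO_pinfty (fun x => counting_fun f x - (h x)%:E)%E g <->
  exists M c, forall x, M < x -> finite_set [set t | f t <= x] /\
    `|#|` fset_set [set t | f t <= x]|%:R - h x| <= c * `|g x|.
Proof.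
split=> [[[M1 [_ fin]] /eqO_exP[c _ [M2 [_ est]]]]|[M [c est]]].
  exists (Num.max M1 M2), c => x; rewrite gt_max => /andP[/fin fx /est /= ex].
  have finx := fin_num_counting_subr _ _ fx.
  by split=> //; move: ex; rewrite /counting_fun (counting_finE _ finx).
split.
  exists M; split; first exact: num_real.
  by move=> x /est[finx _]; rewrite /counting_fun (counting_finE _ finx).
apply/eqO_exP; exists (Num.max 1 c); first by rewrite lt_max ltr01.
exists M; split; first exact: num_real.
move=> x /est[finx estx]; rewrite /counting_fun (counting_finE _ finx)/=.
by apply: (le_trans estx); rewrite ler_wpM2r// le_max lexx orbT.
Qed.

Lemma leq_card_fset_set_sub {T : choiceType} (B B' : set T) :
  finite_set B' -> B `<=` B' -> (#|` fset_set B| <= #|` fset_set B'|)%N.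
Proof.
move=> fin sub; apply: fsubset_leq_card; rewrite -fset_set_sub//.
exact: sub_finite_set sub fin.
Qed.

Lemma power_law_bigO {R : realType} {T : choiceType} (f : T -> R)
    (A alpha eta : R) :
  power_law setT f A alpha eta ->
  bigO_pinfty (fun x => counting_fun f x - (A * x `^ alpha)%:E)%E
    (fun x => x `^ eta).
Proof.
move=> [C fC]; apply/bigO_pinftyP; exists 0, C => x /fC.
by rewrite setTI (ger0_norm (powR_ge0 _ _)).
Qed.

(** For a family bounded below by a positive constant, an estimate near infinity
    extends to all [x > 0]. *)
Lemma bigO_power_law {R : realType} {T : choiceType} (f : T -> R)
    (m A alpha eta : R) :
  0 < m -> (forall t, m <= f t) -> 0 <= eta -> eta <= alpha ->
  bigO_pinfty (fun x => counting_fun f x - (A * x `^ alpha)%:E)%E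
    (fun x => x `^ eta) ->
  power_law setT f A alpha eta.
Proof.
move=> m0 mf eta0 ea /bigO_pinftyP[M0 [c est0]].
pose M := Num.max M0 1; pose y := M + 1.
have M1 : 0 < M by rewrite lt_max ltr01 orbT.
have est x : M < x -> finite_set [set t | f t <= x] /\
    `|#|` fset_set [set t | f t <= x]|%:R - A * x `^ alpha| <= c * x `^ eta.
  by rewrite gt_max => /andP[/est0 + _]; rewrite (ger0_norm (powR_ge0 _ _)).
have My : M < y by rewrite ltrDl.
have c0 : 0 <= c.
  have [_ /(le_trans (normr_ge0 _))] := est y My.
  by rewrite pmulr_lge0// powR_gt0// addr_gt0.
have [finy _] := est y My.
set N := #|` fset_set [set t | f t <= y]|.
(* The three summands handle the range [x > M], the count for [m <= x <= M], and
   the main term for [x <= M]. *)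
exists (c + N%:R / m `^ eta + `|A| * M `^ (alpha - eta)) => x x0.
rewrite setTI; have [Mx|xM] := ltP M x.
  have [finx estx] := est x Mx; split=> //; apply: (le_trans estx).
  rewrite ler_wpM2r ?powR_ge0// -addrA lerDl addr_ge0//.
    by rewrite divr_ge0 ?powR_ge0.
  by rewrite mulr_ge0 ?powR_ge0.
have sub : [set t | f t <= x] `<=` [set t | f t <= y].
  by move=> t /= /le_trans; apply; rewrite (le_trans xM)// lerDl.
split; first exact: sub_finite_set sub finy.
rewrite (le_trans (ler_normB _ _))// -addrA mulrDl.
rewrite ler_wpDl ?mulr_ge0 ?powR_ge0// mulrDl.
apply: lerD.
  rewrite ger0_norm//; have [mx|xm] := leP m x.
    rewrite (@le_trans _ _ N%:R)//; first by rewrite ler_nat leq_card_fset_set_sub.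
    rewrite mulrAC ler_pdivlMr ?powR_gt0// ler_wpM2l//.
    by apply: (ge0_ler_powR eta0); rewrite ?nnegrE// ltW.
  have -> : [set t | f t <= x] = set0.
    apply/seteqP; split=> // t /= ft.
    by have := lt_le_trans xm (mf t); rewrite ltNge ft.
  by rewrite fset_set0 cardfs0 mulr_ge0 ?divr_ge0 ?powR_ge0.
rewrite normrM (ger0_norm (powR_ge0 _ _)) -mulrA ler_wpM2l//.
rewrite -{1}(subrK eta alpha) [x `^ (_ - _ + _)]powRD; last first.
  by rewrite (gt_eqF x0) implybT.
rewrite ler_wpM2r ?powR_ge0// ge0_ler_powR ?subr_ge0 ?nnegrE//; exact: ltW.
Qed.

(** Monotonicity puts [k + 1] terms of [v] in the sublevel set of [v k]. *)
Lemma bigO_counting_growth {R : realType} (v : nat -> R) (tau : R) :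
  (forall k, 0 < v k) -> nondecreasing_seq v -> 0 <= tau ->
  bigO_pinfty (counting_fun v) (fun x => x `^ tau) ->
  exists C, forall k, k.+1%:R <= C * v k `^ tau.
Proof.
move=> v0 vnd tau0 O.
have /bigO_pinftyP[M [c est]] : bigO_pinfty
    (fun x => counting_fun v x - (0 : R)%:E)%E (fun x => x `^ tau).
  by under eq_fun do rewrite sube0.
pose x0 := Num.max (M + 1) (v 0%N).
have x00 : 0 < x0 by rewrite lt_max v0 orbT.
exists (c * (x0 / v 0%N) `^ tau) => k.
(* [v k] may lie below the range where the asymptotic bound holds; the multiple
   [y] of [v k], by a factor independent of [k], lies in that range. *)
pose y := v k * (x0 / v 0%N).
have vk0 : v 0%N <= v k by exact: vnd.
have ge1 : 1 <= x0 / v 0%N by rewrite ler_pdivlMr// mul1r le_max lexx orbT.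
have vy : v k <= y by rewrite ler_peMr// ltW.
have x0y : x0 <= y.
  rewrite /y mulrCA ler_peMr ?(ltW x00)//; by rewrite ler_pdivlMr// mul1r.
have My : M < y.
  by rewrite (lt_le_trans _ x0y)// lt_max ltrDl ltr01.
have [fin] := est y My; rewrite subr0 !ger0_norm ?powR_ge0// => esty.
rewrite -mulrA -powRM ?(ltW (v0 _)) ?(le_trans ler01 ge1)//.
rewrite [_ / _ * _]mulrC (le_trans _ esty)// ler_nat leq_card_fset_set//.
apply: subset_card_le => i /= ik; apply: le_trans vy; exact: vnd.
Qed.

(** * Products of several sequences *)

(** The products over the indices of [r] and [l].  A multi-index only matters
    on [r ++ [:: l]]; requiring it to vanish elsewhere makes each product be
    counted once. *)
Lemma power_law_prod {R : realType} {p : nat} (lam : 'I_p -> nat -> R)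
    (l : 'I_p) (A alpha eta : R) (r : seq 'I_p) :
  (forall j k, 0 < lam j k) -> (forall j, nondecreasing_seq (lam j)) ->
  0 < eta -> uniq (r ++ [:: l]) ->
  (forall j, j \in r -> cvgn [series 1 / lam j k `^ eta]_k) ->
  (forall j, j \in r -> cvgn [series 1 / lam j k `^ alpha]_k) ->
  power_law setT (lam l) A alpha eta ->
  power_law
    [set k : {ffun 'I_p -> nat} | forall i, i \notin r ++ [:: l] -> k i = 0%N]
    (fun k : {ffun 'I_p -> nat} => \prod_(i <- r ++ [:: l]) lam i (k i))
    (A * \prod_(j <- r) limn [series 1 / lam j k `^ alpha]_k) alpha eta.
Proof.
move=> lam0 lamnd eta0 + + + pl; elim: r => [_ _ _|j r IH].
  rewrite big_nil mulr1 /=.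
  apply: (power_law_bij _ _ _ _
    (fun n => [ffun i => if i == l then n else 0%N])) pl.
  - apply/seteqP; split=> [_ [n _ <-] i|k k0] /=.
      by rewrite inE ffunE => /negbTE ->.
    exists (k l) => //; apply/ffunP => i; rewrite ffunE.
    by case: eqP => [->//|/eqP il]; rewrite k0// inE.
  - by move=> n n' _ _ /ffunP/(_ l); rewrite !ffunE eqxx.
  - by move=> n _; rewrite big_seq1 ffunE eqxx.
rewrite cat_cons cons_uniq => /andP[jr ur] cve cva.
have jr_in i : i \in r -> i \in j :: r by rewrite inE orbC => ->.
have {}IH := IH ur (fun i ir => cve i (jr_in i ir)) (fun i ir => cva i (jr_in i ir)).
rewrite big_cons [_ * \prod_(_ <- r) _]mulrC mulrA.
set s := r ++ [:: l] in jr ur IH *.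
pose upd (k : {ffun 'I_p -> nat}) n : {ffun 'I_p -> nat} :=
  [ffun i => if i == j then n else k i].
apply: (power_law_mul _ _ _ _ (lam j) upd (\prod_(i <- s) lam i 0%N)) IH.
- by rewrite prodr_gt0.
- move=> k _; apply: ler_prod => i _; rewrite (ltW (lam0 _ _))/=.
  exact: lamnd.
- exact: lam0.
- exact: eta0.
- apply/seteqP; split=> [k k0|_ [n [k [k0 <-]]] i] /=.
    exists (k j), (upd k 0%N); split.
      move=> i si; rewrite ffunE; case: eqP => // /eqP ij.
      by rewrite k0// inE negb_or ij.
    by apply/ffunP => i; rewrite !ffunE; case: eqP => // ->.
  by rewrite inE negb_or ffunE => /andP[/negbTE -> /k0].
- move=> k n k' n' k0 k'0 /ffunP eqk; split; last first.
    by have := eqk j; rewrite !ffunE eqxx.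
  apply/ffunP => i; have := eqk i; rewrite !ffunE.
  by case: eqP => // -> _; rewrite k0// k'0.
- move=> k n _; rewrite big_cons ffunE eqxx mulrC; congr (_ * _).
  apply: eq_big_seq => i si; rewrite ffunE; case: eqP => // ij.
  by rewrite ij (negbTE jr) in si.
- by apply: cve; rewrite inE eqxx.
- by apply: cva; rewrite inE eqxx.
Qed.

Theorem proposition2p4 (R : realType) (p : nat) (lam : 'I_p -> nat -> R)
    (lam_pos : forall j k, 0 < lam j k)
    (lam_nondecr : forall j, nondecreasing_seq (lam j))
    (tau eta alpha : R) (tau_ge0 : 0 <= tau)
    (tau_lt_eta : tau < eta) (eta_lt_alpha : eta < alpha)
    (l : 'I_p) (A_l : R) (A_l_neq0 : A_l != 0)
    (Nj_bigO : forall j, j != l ->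
      bigO_pinfty (counting_fun (lam j)) (fun x => x `^ tau))
    (Nl_asymp :
      bigO_pinfty (fun x => counting_fun (lam l) x - (A_l * x `^ alpha)%:E)%E
                  (fun x => x `^ eta)) :
  (* convergence of the series defining A *)
  (forall j, j != l -> cvgn [series 1 / lam j k `^ alpha]_k) /\
  let A := A_l * \prod_(j < p | j != l) limn [series 1 / lam j k `^ alpha]_k in
  bigO_pinfty (fun x => counting_fun (prod_family lam) x - (A * x `^ alpha)%:E)%E
              (fun x => x `^ eta).
Proof.
have eta0 : 0 < eta by exact: le_lt_trans tau_lt_eta.
have lam_ge j k : lam j 0%N <= lam j k by exact: lam_nondecr.
have cve j : j != l -> cvgn [series 1 / lam j k `^ eta]_k.
  move=> /Nj_bigO /bigO_counting_growth[]// C.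
  exact: is_cvg_series_powR_growth.
have cva j : j != l -> cvgn [series 1 / lam j k `^ alpha]_k.
  move=> jl; apply: (is_cvg_series_powR_le _ (lam j 0%N) eta) => //.
    exact: ltW.
  exact: cve.
split=> // A; apply: power_law_bigO.
pose r := [seq j <- index_enum 'I_p | j != l].
have inr j : (j \in r) = (j != l) by rewrite mem_filter mem_index_enum andbT.
have ur : uniq (r ++ [:: l]).
  by rewrite cat_uniq filter_uniq ?index_enum_uniq//= inr eqxx.
have perm_r : perm_eq (r ++ [:: l]) (index_enum 'I_p).
  apply: uniq_perm; rewrite ?index_enum_uniq// => j.
  by rewrite mem_cat inr inE orNb mem_index_enum.
have pl := bigO_power_law _ _ _ _ _ (lam_pos l 0%N) (lam_ge l) (ltW eta0)
  (ltW eta_lt_alpha) Nl_asymp.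
have {pl} := power_law_prod lam l A_l alpha eta r lam_pos lam_nondecr eta0 ur
  (fun j jr => cve j (etrans (esym (inr j)) jr))
  (fun j jr => cva j (etrans (esym (inr j)) jr)) pl.
rewrite big_filter.
have -> : [set k : {ffun 'I_p -> nat} |
    forall i, i \notin r ++ [:: l] -> k i = 0%N] = setT.
  apply/seteqP; split=> // k _ i /=.
  by rewrite (perm_mem perm_r) mem_index_enum.
have -> // : (fun k : {ffun 'I_p -> nat} => \prod_(i <- r ++ [:: l]) lam i (k i))
    = prod_family lam.
by apply/funext => k; exact: perm_big.
Qed.
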